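(* Let $L$ be a Lie superalgebra such that $\mathrm{sdim}\, L^{2}=(r\vert s)$ with $r+s$ finite, and suppose that $L/Z(L)$ is a $(p\vert q)$-generator Lie superalgebra. Then $$\mathrm{sdim}\, L/Z(L)\leq \lambda(L^{2},p,q),$$ where $$\lambda(L^{2},p,q)=\left(p\cdot\dim L^{2}_{\overline{0}}+q\cdot\dim L^{2}_{\overline{1}},\; q\cdot\dim L^{2}_{\overline{0}}+p\cdot\dim L^{2}_{\overline{1}}\right).$$
   Context: Lie superalgebras are over a field of characteristic not equal to $2$ or $3$. For a Lie superalgebra $L=L_{\overline{0}}\oplus L_{\overline{1}}$, the superdimension is $\mathrm{sdim}\,L=(\dim L_{\overline{0}},\dim L_{\overline{1}})$, also written $(\dim L_{\overline{0}}\vert\dim L_{\overline{1}})$. $L^{2}=[L,L]$ is the derived superalgebra, with even and odd parts $L^2_{\overline{0}}$, $L^2_{\overline{1}}$, and $Z(L)$ is the center. A Lie superalgebra is a $(p\vert q)$-generator ($(p\vert q)$-generated) Lie superalgebra if it has a minimal generating set consisting of $p$ even and $q$ odd homogeneous elements ($p,q$ finite); $(p\vert q)$ is called its minimal generator number pair. The inequality between pairs is componentwise. $L$ is not assumed finite-dimensional. *)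

(* Defs.v *)
From HB Require Import structures.
From mathcomp Require Import all_boot all_algebra.
From mathcomp Require Import boolp.

Set Implicit Arguments.
Unset Strict Implicit.
Unset Printing Implicit Defensive.

Import GRing.Theory.
Local Open Scope ring_scope.
Local Open Scope quotient_scope.

(* Degrees in Z/2 are booleans: false is even, true is odd, (+) is addition
   and && is multiplication.  These axioms are the right ones when 2 and 3 are
   invertible in F; in characteristic 2 or 3 further axioms on [x, x] and
   [x, [x, x]] would be needed. *)
HB.mixin Record Lmodule_isLieSuperalgebra (F : fieldType) L
    of GRing.Lmodule F L := {
  homog : bool -> {pred L};
  bracket : L -> L -> L;
  homog_submod : forall i, submod_closed (homog i);
  homog_decomp : forall x, exists x0 x1,
    [/\ x0 \in homog false, x1 \in homog true & x = x0 + x1];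
  homog_direct : forall x, x \in homog false -> x \in homog true -> x = 0;
  bracket_linearl : forall y, linear (bracket^~ y);
  bracket_linearr : forall x, linear (bracket x);
  bracket_homog : forall i j x y, x \in homog i -> y \in homog j ->
    bracket x y \in homog (i (+) j);
  bracket_skew : forall i j x y, x \in homog i -> y \in homog j ->
    bracket x y = - ((-1) ^+ (i && j) *: bracket y x);
  bracket_jacobi : forall i j x y z, x \in homog i -> y \in homog j ->
    bracket x (bracket y z) =
      bracket (bracket x y) z + (-1) ^+ (i && j) *: bracket y (bracket x z)
}.

#[short(type="lieSuperalgType")]
HB.structure Definition LieSuperalgebra (F : fieldType) :=
  {L of GRing.Lmodule F L & Lmodule_isLieSuperalgebra F L}.

Arguments homog {F s} _.
Arguments homog_submod {F s} i.
Arguments homog_decomp {F s} x.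
Arguments homog_direct {F s x}.
Arguments bracket_homog {F s i j x y}.
Arguments bracket_skew {F s i j x y}.
Arguments bracket_jacobi {F s i j x y} z.

Section Dimension.
Variables (F : fieldType) (M : lmodType F).

Definition lspan (A : {pred M}) : {pred M} :=
  [pred x | `[< exists (n : nat) (c : 'I_n -> F) (v : 'I_n -> M),
                (forall i, v i \in A) /\ x = \sum_i c i *: v i >]].

(* A relation rather than a function, so that it also asserts that V is
   finite dimensional. *)
Definition has_dim (V : {pred M}) (n : nat) : Prop :=
  exists e : 'I_n -> M,
    (forall c : 'I_n -> F, \sum_i c i *: e i = 0 -> forall i, c i = 0) /\
    (forall x, x \in V <-> exists c : 'I_n -> F, x = \sum_i c i *: e i).

End Dimension.

Section LieSuperalgebraTheory.
Variables (F : fieldType) (L : lieSuperalgType F).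

Definition is_graded (S : {pred L}) : Prop :=
  forall x, x \in S -> exists x0 x1,
    [/\ x0 \in [predI S & homog false], x1 \in [predI S & homog true]
      & x = x0 + x1].

Definition has_sdim (V : {pred L}) (d : nat * nat) : Prop :=
  has_dim [predI V & homog false] d.1 /\ has_dim [predI V & homog true] d.2.

Definition is_subsuperalgebra (S : {pred L}) : Prop :=
  [/\ submod_closed S, is_graded S
    & forall x y, x \in S -> y \in S -> bracket x y \in S].

Definition generates (A : {pred L}) : Prop :=
  forall S : {pred L}, is_subsuperalgebra S -> {subset A <= S} ->
    forall x, x \in S.

(* Minimality is with respect to inclusion. *)
Definition pq_generated (p q : nat) : Prop :=
  exists xs ys : seq L,
    [/\ [/\ size xs = p, size ys = q & uniq (xs ++ ys)],
        {subset xs <= homog false}, {subset ys <= homog true},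
        generates (mem (xs ++ ys))
      & forall A : {pred L}, {subset A <= xs ++ ys} -> generates A ->
          {subset xs ++ ys <= A}].

Definition derived : {pred L} :=
  lspan [pred x : L | `[< exists y z : L, x = bracket y z >]].

Definition center_pred : {pred L} :=
  [pred x | `[< forall y, bracket x y = 0 >]].

(* Closure under brackets on one side suffices for a graded subspace, by
   skew-supersymmetry. *)
Record gradedIdeal := GradedIdeal {
  ideal_pred : {pred L};
  ideal_submod : submod_closed ideal_pred;
  ideal_graded : is_graded ideal_pred;
  ideal_bracket : forall x y, y \in ideal_pred -> bracket x y \in ideal_pred
}.

Lemma homog0 i : 0 \in homog (s:=L) i.
Proof. by case: (homog_submod (s:=L) i). Qed.

Lemma homogZD i a x y : x \in homog (s:=L) i -> y \in homog i ->
  a *: x + y \in homog i.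
Proof. by move=> hx hy; case: (homog_submod (s:=L) i) => _; apply. Qed.

Lemma homogD i x y : x \in homog (s:=L) i -> y \in homog i ->
  x + y \in homog i.
Proof. by move=> hx hy; rewrite -[x]scale1r homogZD. Qed.

Lemma homogN i x : x \in homog (s:=L) i -> - x \in homog i.
Proof. by move=> hx; rewrite -[- x]addr0 -scaleN1r homogZD ?homog0. Qed.

Lemma bracketDl x y z : bracket (x + y) z = bracket x z + bracket y z :> L.
Proof. by rewrite -{1}[x]scale1r bracket_linearl scale1r. Qed.

Lemma bracketDr x y z : bracket z (x + y) = bracket z x + bracket z y :> L.
Proof. by rewrite -{1}[x]scale1r bracket_linearr scale1r. Qed.

Lemma bracket0l z : bracket 0 z = 0 :> L.
Proof. by apply: (@addrI _ (bracket 0 z)); rewrite -bracketDl !addr0. Qed.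

Lemma bracket0r z : bracket z 0 = 0 :> L.
Proof. by apply: (@addrI _ (bracket z 0)); rewrite -bracketDr !addr0. Qed.

Lemma bracketNl x z : bracket (- x) z = - bracket x z :> L.
Proof. by apply: (@addrI _ (bracket x z)); rewrite -bracketDl !subrr bracket0l. Qed.

Lemma bracketNr x z : bracket z (- x) = - bracket z x :> L.
Proof. by apply: (@addrI _ (bracket z x)); rewrite -bracketDr !subrr bracket0r. Qed.

Lemma homog_eq0 (x y : L) : x \in homog false -> y \in homog true ->
  x + y = 0 -> x = 0 /\ y = 0.
Proof.
move=> hx hy /eqP; rewrite addr_eq0 => /eqP xy.
have x0 : x = 0 by apply: homog_direct hx _; rewrite xy homogN.
by split=> //; apply: oppr_inj; rewrite -xy x0 oppr0.
Qed.

Lemma center_submod : submod_closed center_pred.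
Proof.
split; first by apply/asboolP => y; rewrite bracket0l.
move=> a x y /asboolP hx /asboolP hy; apply/asboolP => z.
by rewrite bracket_linearl hx hy scaler0 addr0.
Qed.

Lemma center_graded : is_graded center_pred.
Proof.
move=> x /asboolP xZ; have [x0 [x1 [h0 h1 xE]]] := homog_decomp x.
have hom i y : y \in homog i -> bracket x0 y = 0 /\ bracket x1 y = 0.
  move=> hy; have := xZ y; rewrite xE bracketDl.
  have := bracket_homog h0 hy; have := bracket_homog h1 hy.
  case: i hy => /= _ b1 b0.
    by rewrite addrC => /(homog_eq0 b1 b0) [].
  by move=> /(homog_eq0 b0 b1).
exists x0, x1; split=> //; apply/andP; split=> //; apply/asboolP => y;
  have [y0 [y1 [/hom[a0 a1] /hom[b0 b1] ->]]] := homog_decomp y;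
  by rewrite bracketDr ?a0 ?a1 ?b0 ?b1 addr0.
Qed.

Lemma center_bracket x y : y \in center_pred -> bracket x y \in center_pred.
Proof.
move=> yZ; suff -> : bracket x y = 0 by case: center_submod.
have [y0 [y1 [/andP[z0 h0] /andP[z1 h1] ->]]] := center_graded yZ.
have [x0 [x1 [g0 g1 ->]]] := homog_decomp x.
move: z0 z1 => /asboolP z0 /asboolP z1; rewrite !bracketDl !bracketDr.
rewrite (bracket_skew g0 h0) (bracket_skew g0 h1).
rewrite (bracket_skew g1 h0) (bracket_skew g1 h1).
by rewrite !z0 !z1 !scaler0 !oppr0 !addr0.
Qed.

Definition center : gradedIdeal :=
  GradedIdeal center_submod center_graded center_bracket.

End LieSuperalgebraTheory.

Arguments derived {F} L _.
Arguments center_pred {F} L _.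
Arguments center {F} L.

HB.instance Definition _ (F : fieldType) (L : lieSuperalgType F)
    (I : gradedIdeal L) :=
  GRing.isSubmodClosed.Build F L (ideal_pred I) (ideal_submod I).

Definition lieQuot (F : fieldType) (L : lieSuperalgType F)
  (I : gradedIdeal L) : Type := Quotient.quot (ideal_pred I).

Section LieQuotient.
Variables (F : fieldType) (L : lieSuperalgType F) (I : gradedIdeal L).
Local Notation Q := (lieQuot I).

HB.instance Definition _ := GRing.Zmodule.on Q.
HB.instance Definition _ := Quotient.on Q.

Definition lieProj (x : L) : Q := \pi_(Quotient.quot (ideal_pred I)) x.

Lemma lieProj_eq x y : lieProj x = lieProj y <-> x - y \in ideal_pred I.
Proof.
rewrite Quotient.idealrBE; split=> [h|/eqP //]; exact/eqP.
Qed.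

Lemma lieProjK (u : Q) : lieProj (repr u) = u.
Proof. exact: reprK. Qed.

Lemma lieProj_surj (u : Q) : exists x, u = lieProj x.
Proof. by exists (repr u); rewrite lieProjK. Qed.

Lemma lieProj0 : lieProj 0 = 0.
Proof. exact: pi_zeror. Qed.

Lemma lieProjD x y : lieProj (x + y) = lieProj x + lieProj y.
Proof. exact: pi_addr. Qed.

Lemma lieProjN x : lieProj (- x) = - lieProj x.
Proof. exact: pi_oppr. Qed.

Definition quotScale (a : F) (u : Q) : Q := lieProj (a *: repr u).

Lemma quotScaleE a x : quotScale a (lieProj x) = lieProj (a *: x).
Proof.
apply/lieProj_eq; rewrite -scalerBr; apply: rpredZ.
by apply/lieProj_eq; rewrite lieProjK.
Qed.

Lemma quotScaleA a b u : quotScale a (quotScale b u) = quotScale (a * b) u.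
Proof. by have [x ->] := lieProj_surj u; rewrite !quotScaleE scalerA. Qed.

Lemma quotScale1 : left_id 1 quotScale.
Proof. by move=> u; have [x ->] := lieProj_surj u; rewrite quotScaleE scale1r. Qed.

Lemma quotScaleDr : right_distributive quotScale +%R.
Proof.
move=> a u v; have [x ->] := lieProj_surj u; have [y ->] := lieProj_surj v.
by rewrite -lieProjD !quotScaleE -lieProjD scalerDr.
Qed.

Lemma quotScaleDl u : {morph quotScale^~ u : a b / a + b}.
Proof.
move=> a b; have [x ->] := lieProj_surj u.
by rewrite !quotScaleE -lieProjD scalerDl.
Qed.

HB.instance Definition _ := GRing.Zmodule_isLmodule.Build F Q
  quotScaleA quotScale1 quotScaleDr quotScaleDl.

Lemma lieProjZ a x : lieProj (a *: x) = a *: lieProj x.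
Proof. by rewrite -quotScaleE. Qed.

Definition quotBracket (u v : Q) : Q := lieProj (bracket (repr u) (repr v)).

Lemma ideal_bracketl (x y : L) : x \in ideal_pred I ->
  bracket x y \in ideal_pred I.
Proof.
move=> xI; have [x0 [x1 [/andP[i0 h0] /andP[i1 h1] ->]]] := ideal_graded xI.
have [y0 [y1 [g0 g1 ->]]] := homog_decomp y.
rewrite !bracketDl !bracketDr.
rewrite (bracket_skew h0 g0) (bracket_skew h0 g1).
rewrite (bracket_skew h1 g0) (bracket_skew h1 g1).
by rewrite !(rpredD, rpredN) //; apply: rpredZ; apply: ideal_bracket.
Qed.

Lemma quotBracketE x y :
  quotBracket (lieProj x) (lieProj y) = lieProj (bracket x y).
Proof.
apply/lieProj_eq; set x' := repr _; set y' := repr _.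
have -> : bracket x' y' - bracket x y =
    bracket (x' - x) y' + bracket x (y' - y).
  by rewrite bracketDl bracketNl bracketDr bracketNr addrA subrK.
apply: rpredD; [apply: ideal_bracketl | apply: ideal_bracket];
  by apply/lieProj_eq; rewrite lieProjK.
Qed.

Definition quotHomog (i : bool) : {pred Q} :=
  [pred u | `[< exists2 x, x \in homog i & u = lieProj x >]].

Lemma quotHomogP i u :
  reflect (exists2 x, x \in homog i & u = lieProj x) (u \in quotHomog i).
Proof. exact: asboolP. Qed.

Lemma quotHomog_submod i : submod_closed (quotHomog i).
Proof.
split; first by apply/quotHomogP; exists 0; rewrite ?homog0 ?lieProj0.
move=> a _ _ /quotHomogP[x hx ->] /quotHomogP[y hy ->]; apply/quotHomogP.
by exists (a *: x + y); rewrite ?homogZD // lieProjD lieProjZ.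
Qed.

Lemma quotHomog_decomp u : exists u0 u1,
  [/\ u0 \in quotHomog false, u1 \in quotHomog true & u = u0 + u1].
Proof.
have [x ->] := lieProj_surj u; have [x0 [x1 [h0 h1 ->]]] := homog_decomp x.
exists (lieProj x0), (lieProj x1); rewrite lieProjD.
by split=> //; apply/quotHomogP; [exists x0 | exists x1].
Qed.

Lemma quotHomog_direct u :
  u \in quotHomog false -> u \in quotHomog true -> u = 0.
Proof.
move=> /quotHomogP[x hx ->] /quotHomogP[y hy /lieProj_eq].
move=> /ideal_graded[z0 [z1 [/andP[i0 h0] /andP[i1 h1] /eqP]]].
rewrite -subr_eq0 opprD addrACA => /eqP e.
rewrite -lieProj0; apply/lieProj_eq; rewrite subr0.
suff /eqP : x - z0 = 0 by rewrite subr_eq0 => /eqP ->.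
have : - y - z1 \in homog true by rewrite homogD ?homogN.
have : x - z0 \in homog false by rewrite homogD ?homogN.
by move=> a b; have [] := homog_eq0 a b e.
Qed.

Lemma quotBracket_linearl v : linear (quotBracket^~ v).
Proof.
move=> a u u'; have [x ->] := lieProj_surj u; have [y ->] := lieProj_surj u'.
have [z ->] := lieProj_surj v.
by rewrite -lieProjZ -lieProjD !quotBracketE -lieProjZ -lieProjD bracket_linearl.
Qed.

Lemma quotBracket_linearr v : linear (quotBracket v).
Proof.
move=> a u u'; have [x ->] := lieProj_surj u; have [y ->] := lieProj_surj u'.
have [z ->] := lieProj_surj v.
by rewrite -lieProjZ -lieProjD !quotBracketE -lieProjZ -lieProjD bracket_linearr.
Qed.

Lemma quotBracket_homog i j u v : u \in quotHomog i -> v \in quotHomog j ->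
  quotBracket u v \in quotHomog (i (+) j).
Proof.
move=> /quotHomogP[x hx ->] /quotHomogP[y hy ->]; apply/quotHomogP.
by exists (bracket x y); rewrite ?bracket_homog ?quotBracketE.
Qed.

Lemma quotBracket_skew i j u v : u \in quotHomog i -> v \in quotHomog j ->
  quotBracket u v = - ((-1) ^+ (i && j) *: quotBracket v u).
Proof.
move=> /quotHomogP[x hx ->] /quotHomogP[y hy ->].
by rewrite !quotBracketE -lieProjZ -lieProjN (bracket_skew hx hy).
Qed.

Lemma quotBracket_jacobi i j u v w : u \in quotHomog i -> v \in quotHomog j ->
  quotBracket u (quotBracket v w) =
    quotBracket (quotBracket u v) w +
      (-1) ^+ (i && j) *: quotBracket v (quotBracket u w).
Proof.
move=> /quotHomogP[x hx ->] /quotHomogP[y hy ->].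
have [z ->] := lieProj_surj w.
by rewrite !quotBracketE -lieProjZ -lieProjD (bracket_jacobi _ hx hy).
Qed.

HB.instance Definition _ := Lmodule_isLieSuperalgebra.Build F Q
  quotHomog_submod quotHomog_decomp quotHomog_direct
  quotBracket_linearl quotBracket_linearr
  quotBracket_homog quotBracket_skew quotBracket_jacobi.

End LieQuotient.

(* lambda d p q, where d is the superdimension of the derived superalgebra. *)
Definition lambda (d : nat * nat) (p q : nat) : nat * nat :=
  (p * d.1 + q * d.2, q * d.1 + p * d.2)%N.

(* Main.v *)
Require Import Defs.
From HB Require Import structures.
From mathcomp Require Import all_boot all_algebra.
From mathcomp Require Import boolp.

(** Lift the [p] even and [q] odd generators of [L/Z(L)] to homogeneous elements
    [g_1, ..., g_m] of [L], and fix a parity [i].  For [z] in [L_i] consider the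
    brackets [[g_k, z]]: each of them lies in the component of [L^2] of degree
    [i + deg g_k], so together they take at most [N] coordinates, where [N] is
    the sum over [k] of the dimensions of these components.  This [N] is the
    component of [lambda] in degree [i].

    If all the brackets [[g_k, z]] vanish, then [z] is central
    ([centralizes_generators]): by the Jacobi identity, the elements which
    annihilate a homogeneous [z] form a graded subalgebra; its image in [L/Z(L)]
    contains the generators, hence is everything, and central elements do
    annihilate [z].  So [z |-> ([g_k, z])_k] is linear on [L_i] with kernel in
    [Z(L)]: any [N + 1] elements of [L_i] have a nontrivial combination which
    vanishes modulo [Z(L)] ([common_kernel]), and so [(L/Z(L))_i] has dimension
    at most [N] ([has_dim_bound]). *)

Set Implicit Arguments.
Unset Strict Implicit.
Unset Printing Implicit Defensive.

Import GRing.Theory.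
Local Open Scope ring_scope.

Lemma wide_matrix_kernel (F : fieldType) (T : finType) n (a : 'I_n -> T -> F) :
  (#|T| < n)%N ->
  exists2 c : 'I_n -> F, (exists j, c j != 0) & forall t, \sum_j c j * a j t = 0.
Proof.
move=> ltTn; pose A := \matrix_(j < n, t < #|T|) a j (enum_val t).
have : kermx A != 0.
  by rewrite kermx_eq0 /row_free ltn_eqF // (leq_ltn_trans (rank_leq_col A)).
case/rowV0Pn => v /sub_kermxP vA /rV0Pn[j vj]; exists (v 0); first by exists j.
move=> t; have /rowP/(_ (enum_rank t)) := vA; rewrite !mxE => vAt.
by rewrite -[RHS]vAt; apply: eq_bigr => k _; rewrite mxE enum_rankK.
Qed.

(** Expanding each [f t (z j)] in a basis of [V t] turns the vanishing of all
    [f t] on a combination of the [z j] into [\sum_t d t] scalar equations in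
    the [n] coefficients. *)
Lemma common_kernel (F : fieldType) (M M' : lmodType F) (T : finType)
    (f : T -> {linear M -> M'}) (V : T -> {pred M'}) (d : T -> nat) n
    (z : 'I_n -> M) :
  (forall t, has_dim (V t) (d t)) -> (forall t j, f t (z j) \in V t) ->
  (\sum_t d t < n)%N ->
  exists2 c : 'I_n -> F, (exists j, c j != 0) &
    forall t, f t (\sum_j c j *: z j) = 0.
Proof.
move=> dimV fV lt_n; pose e t := sval (cid (dimV t)).
have coord t j : {a : 'I_(d t) -> F | f t (z j) = \sum_i a i *: e t i}.
  apply: cid; rewrite /e; case: cid => e' /= [_ spanV].
  by apply/spanV.
(* The equations are indexed by pairs of some t and a basis index of V t. *)
pose a j (u : {t & 'I_(d t)}) := sval (coord (tag u) j) (tagged u).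
have [|c c_neq0 c0] := @wide_matrix_kernel F _ n a.
  rewrite card_tagged sumnE big_map big_enum /=.
  by under eq_bigr => t _ do rewrite card_ord.
exists c => // t; rewrite linear_sum /=.
under eq_bigr => j _ do
  rewrite linearZ /= (svalP (coord t j)) scaler_sumr.
rewrite exchange_big big1 // => i _.
under eq_bigr => j _ do rewrite scalerA.
by rewrite -scaler_suml (c0 (Tagged (fun t => 'I_(d t)) i)) scale0r.
Qed.

(** Starting from the empty family, an independent family which does not span
    [V] is extended by a vector outside its span; this must stop, as a family
    of [N + 1] vectors is never independent. *)
Lemma has_dim_bound (F : fieldType) (M : lmodType F) (V : {pred M}) N :
  submod_closed V ->
  (forall v : 'I_N.+1 -> M, (forall j, v j \in V) ->
    exists2 c : 'I_N.+1 -> F, (exists j, c j != 0) & \sum_j c j *: v j = 0) ->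
  exists2 d, (d <= N)%N & has_dim V d.
Proof.
move=> [V0 VZD] dep.
pose indep n (e : 'I_n -> M) := (forall j, e j \in V) /\
  forall c : 'I_n -> F, \sum_j c j *: e j = 0 -> forall j, c j = 0.
suff ext m : forall n (e : 'I_n -> M), (n + m)%N = N.+1 -> indep n e ->
    exists2 d, (d <= N)%N & has_dim V d.
  apply: (ext N.+1 0%N (fun=> 0)) => //.
  by split=> [[]|c _ []].
elim: m => [|m IHm] n e.
  rewrite addn0 => En; subst n => -[eV ind].
  by have [c [j /eqP cj] /ind/(_ j)] := dep e eV.
move=> En [eV ind].
have spanV (c : 'I_n -> F) : \sum_j c j *: e j \in V.
  by elim/big_rec: _ => // j x _ xV; apply: VZD.
have [spans|] := pselect (forall x, x \in V ->
    exists c : 'I_n -> F, x = \sum_j c j *: e j).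
  exists n; first by rewrite -ltnS -En -addSnnS leq_addr.
  by exists e; split=> // x; split=> [/spans//|[c ->]].
move=> /existsNP[x /not_implyP [xV x_out]].
apply: (IHm n.+1 (fun j => oapp e x (unlift ord0 j))).
  by rewrite addSnnS.
split=> [j|c]; first by case: unlift => [k|]; [apply: eV|].
rewrite big_ord_recl unlift_none /=.
under eq_bigr => j _ do rewrite liftK /=.
have [c0 | c0 sum0] := eqVneq (c ord0) 0.
  rewrite c0 scale0r add0r => /ind cl j.
  by case: (unliftP ord0 j) => [k|] ->.
case: x_out; exists (fun j => - (c ord0)^-1 * c (lift ord0 j)).
under eq_bigr => j _ do rewrite -scalerA.
rewrite -scaler_sumr; move: sum0 => /eqP; rewrite addrC addr_eq0 => /eqP ->.
by rewrite scalerN scaleNr opprK scalerA mulVf ?scale1r.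
Qed.

Section CentralQuotient.
Variables (F : fieldType) (L : lieSuperalgType F).

HB.instance Definition _ (x : L) :=
  GRing.isLinear.Build F L L *:%R (bracket x) (bracket_linearr x).

Lemma lieProj_linear (I : gradedIdeal L) : linear (@lieProj F L I).
Proof. by move=> a x y; rewrite lieProjD lieProjZ. Qed.

HB.instance Definition _ (I : gradedIdeal L) :=
  GRing.isLinear.Build F L (lieQuot I) *:%R (@lieProj F L I)
    (@lieProj_linear I).

Lemma bracket_derived (x y : L) : bracket x y \in derived L.
Proof.
apply/asboolP; exists 1%N, (fun=> 1), (fun=> bracket x y).
by split=> [_|]; [apply/asboolP; exists x, y | rewrite big_ord1 scale1r].
Qed.

(** Bracketing with a homogeneous [z] separates degrees, so it kills [c] only
    if it kills both homogeneous parts of [c]. *)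
Lemma annihilator_graded i (z c : L) : z \in homog i -> bracket c z = 0 ->
  exists c0 c1, [/\ c0 \in homog false, c1 \in homog true, bracket c0 z = 0,
    bracket c1 z = 0 & c = c0 + c1].
Proof.
move=> hz; have [c0 [c1 [h0 h1 ->]]] := homog_decomp c.
rewrite bracketDl => e; suff [] : bracket c0 z = 0 /\ bracket c1 z = 0.
  by exists c0, c1.
have := bracket_homog h0 hz; have := bracket_homog h1 hz.
case: i {hz} => /= b1 b0; last exact: homog_eq0.
by rewrite addrC in e; case: (homog_eq0 b1 b0 e).
Qed.

(** The Jacobi identity says that [bracket (bracket x y) z] is a combination of
    [bracket x (bracket y z)] and [bracket y (bracket x z)] when [x] and [y] are
    homogeneous; [annihilator_graded] reduces the general case to this one. *)
Lemma annihilator_bracket i (z c c' : L) : z \in homog i ->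
  bracket c z = 0 -> bracket c' z = 0 -> bracket (bracket c c') z = 0.
Proof.
move=> hz.
move=> /(annihilator_graded hz)[c0 [c1 [h0 h1 c0z c1z ->]]].
move=> /(annihilator_graded hz)[d0 [d1 [g0 g1 d0z d1z ->]]].
have jac j k x y : x \in homog j -> y \in homog k -> bracket x z = 0 ->
    bracket y z = 0 -> bracket (bracket x y) z = 0.
  move=> hx hy xz yz; have := bracket_jacobi z hx hy.
  by rewrite xz yz !bracket0r scaler0 addr0 => <-.
rewrite !bracketDl !bracketDr !bracketDl.
by rewrite (jac _ _ _ _ h0 g0) ?(jac _ _ _ _ h0 g1) ?(jac _ _ _ _ h1 g0)
  ?(jac _ _ _ _ h1 g1) // !addr0.
Qed.

Local Notation Q := (lieQuot (center L)).

Lemma image_annihilator_subsuperalgebra i (z : L) : z \in homog i ->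
  is_subsuperalgebra
    [pred u : Q | `[< exists2 c, bracket c z = 0 & u = lieProj _ c >]].
Proof.
move=> hz; split.
- split; first by apply/asboolP; exists 0; rewrite ?bracket0l ?lieProj0.
  move=> a _ _ /asboolP[c cz ->] /asboolP[d dz ->]; apply/asboolP.
  by exists (a *: c + d); rewrite ?linearP // bracket_linearl cz dz scaler0 addr0.
- move=> _ /asboolP[c cz ->].
  have [c0 [c1 [h0 h1 c0z c1z ->]]] := annihilator_graded hz cz.
  exists (lieProj _ c0), (lieProj _ c1); rewrite lieProjD; split=> //.
    by apply/andP; split; apply/asboolP; exists c0.
  by apply/andP; split; apply/asboolP; exists c1.
- move=> _ _ /asboolP[c cz ->] /asboolP[d dz ->]; apply/asboolP.
  exists (bracket c d); first exact: annihilator_bracket hz cz dz.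
  exact: quotBracketE.
Qed.

Variables (T : finType) (g : T -> L).
Hypothesis gen : forall A : {pred Q}, (forall t, lieProj _ (g t) \in A) ->
  is_subsuperalgebra A -> forall u, u \in A.

(** By generation, every [w] agrees modulo the center with some [c] such that
    [bracket c z = 0], and [w - c], being central, annihilates [z] as well.  So
    [bracket w z = 0] for all [w], and skew-supersymmetry turns this around. *)
Lemma centralizes_generators i (z : L) : z \in homog i ->
  (forall t, bracket (g t) z = 0) -> z \in center_pred L.
Proof.
move=> hz gz.
have zl w : bracket w z = 0.
  have /gen/(_ (image_annihilator_subsuperalgebra hz)) : forall t,
      lieProj _ (g t) \in [pred u : Q | `[< exists2 c, bracket c z = 0 &
        u = lieProj _ c >]] by move=> t; apply/asboolP; exists (g t).
  case/(_ (lieProj _ w))/asboolP => c cz /lieProj_eq/asboolP/(_ z).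
  by rewrite bracketDl bracketNl cz subr0.
apply/asboolP => y; have [y0 [y1 [h0 h1 ->]]] := homog_decomp y.
by rewrite bracketDr (bracket_skew hz h0) (bracket_skew hz h1) !zl !scaler0
  oppr0 addr0.
Qed.

(** The degree of [bracket (g t) z] depends on [t], so each generator
    contributes the dimension of the component of [derived L] in its own
    degree shifted by [i]. *)
Lemma homog_central_quotient_dim (b : T -> bool) (d : bool -> nat) i :
  (forall t, g t \in homog (b t)) ->
  (forall j, has_dim [predI derived L & homog j] (d j)) ->
  exists2 n, (n <= \sum_t d (b t (+) i))%N & has_dim (homog i : {pred Q}) n.
Proof.
move=> hg dimd; apply: has_dim_bound; first exact: homog_submod.
move=> v vi.
have lift j : {x | x \in homog i & v j = lieProj _ x}.
  by apply: cid2; apply/quotHomogP/vi.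
pose z j := s2val (lift j); have hz j : z j \in homog i := s2valP (lift j).
have [||//|c c_neq0 c0] := common_kernel
  (f := fun t => bracket (g t))
  (V := fun t => [predI derived L & homog (b t (+) i)])
  (d := fun t => d (b t (+) i)) (z := z).
- by move=> t; apply: dimd.
- by move=> t j; rewrite inE /= bracket_derived bracket_homog.
exists c => //; transitivity (\sum_j lieProj (center L) (c j *: z j)).
  by apply: eq_bigr => j _; rewrite (s2valP' (lift j)) -lieProjZ.
rewrite -linear_sum -lieProj0; apply/lieProj_eq; rewrite subr0.
apply: centralizes_generators c0.
apply: (big_rec (fun x => x \in homog i)) => [|j x _]; first exact: homog0.
exact: homogZD.
Qed.

End CentralQuotient.

Local Close Scope ring_scope.

Theorem theorem2p1 (F : fieldType)
    (hF2 : 2%N \notin [pchar F]%R) (hF3 : 3%N \notin [pchar F]%R)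
    (L : lieSuperalgType F) (r s p q : nat) :
  has_sdim (derived L) (r, s) ->
  pq_generated (lieQuot (center L)) p q ->
  exists d : nat * nat,
    has_sdim (predT : {pred lieQuot (center L)}) d /\
    (d.1 <= (lambda (r, s) p q).1 /\ d.2 <= (lambda (r, s) p q).2).
Proof.
move=> [dim0 dim1] [xs [ys [[sz_xs sz_ys _] xs0 ys1 gen _]]].
(* The first p generators are even and the last q odd. *)
pose b (k : 'I_(p + q)) := (p <= k)%N.
pose u (k : 'I_(p + q)) := nth 0%R (xs ++ ys) k.
have lift k : {x : L | x \in homog (b k) & u k = lieProj _ x}.
  apply: cid2; apply/quotHomogP; rewrite /u /b nth_cat sz_xs ltnNge.
  case: leqP => [le_pk | lt_kp] /=; [apply: ys1 | apply: xs0]; apply: mem_nth.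
    by rewrite sz_ys ltn_subLR.
  by rewrite sz_xs.
pose g k := s2val (lift k).
have genA (A : {pred lieQuot (center L)}) : (forall t, lieProj _ (g t) \in A) ->
    is_subsuperalgebra A -> forall w, w \in A.
  move=> gA subA; apply: gen subA _ => w /(nthP 0%R)[k].
  rewrite size_cat sz_xs sz_ys => lt_k <-.
  by have := gA (Ordinal lt_k); rewrite -(s2valP' (lift _)).
have hg k : g k \in homog (b k) := s2valP (lift k).
pose dim (j : bool) := if j then s else r.
have dimP j : has_dim [predI derived L & homog j] (dim j) by case: j.
have sumE i : \sum_k dim (b k (+) i) = (p * dim i + q * dim (~~ i))%N.
  rewrite big_split_ord /=; congr (_ + _)%N.
    under eq_bigr => k _ do rewrite /b /= leqNgt ltn_ord /=.
    by rewrite sum_nat_const card_ord.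
  under eq_bigr => k _ do rewrite /b /= leq_addr /=.
  by rewrite sum_nat_const card_ord.
have homP i n : has_dim (homog i : {pred lieQuot (center L)}) n ->
    has_dim [predI (predT : {pred lieQuot (center L)}) & homog i] n.
  by [].
have [n0 le0 /homP dn0] := homog_central_quotient_dim genA false hg dimP.
have [n1 le1 /homP dn1] := homog_central_quotient_dim genA true hg dimP.
exists (n0, n1); split; first by split.
rewrite sumE in le0; rewrite sumE in le1.
by split=> //=; rewrite addnC.
Qed.
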